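(* Let $A = \{a, a+d, \ldots, a+(n-1)d\}$ be a set of numbers in an arithmetic progression, where $a\ge 0$, $d\ge 1$ and $n\ge 1$ are integers, and let $m_1, m_2\in\mathbb{N}$. Then $A\cup\{m_1,m_2\}$ is not sum-dominant.
   Context: $\mathbb{N}$ denotes the set of nonnegative integers. For a set $A$ of nonnegative integers, define $A+A = \{a+a' \mid a,a'\in A\}$ and $A-A=\{a-a' \mid a,a'\in A\}$. The set $A$ is called sum-dominant if $|A+A|>|A-A|$. *)

(* Defs.v *)
From HB Require Import structures.
From mathcomp Require Import all_boot all_order all_algebra.
From mathcomp Require Import finmap.

Set Implicit Arguments.
Unset Strict Implicit.
Unset Printing Implicit Defensive.

Local Open Scope fset_scope.

Definition sumset (A : {fset nat}) : {fset nat} :=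
  [fset (x + y)%N | x in A, y in A].

(* Differences are taken in [int]: subtraction on [nat] is truncated. *)
Definition diffset (A : {fset nat}) : {fset int} :=
  [fset (x%:Z - y%:Z)%R | x in A, y in A].

Definition sum_dominant (A : {fset nat}) : bool :=
  (#|` diffset A| < #|` sumset A|)%N.

Definition arith_prog (a d n : nat) : {fset nat} :=
  [fset (a + i * d)%N | i in iota 0 n].

(* Main.v *)
Require Import Defs.
From HB Require Import structures.
From mathcomp Require Import all_boot all_order all_algebra.
From mathcomp Require Import finmap.
From mathcomp Require Import zify.

Import Order.TTheory GRing.Theory Num.Theory.
Local Open Scope ring_scope.

(** Put P for the progression, c for the sum of its first and last terms, and
    write p' = 2 p - c.  The set P' is symmetric about 0, so that, after this
    affine change of variable, P + P and P - P both become the same set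
    Q = P' + P'.  Let u and v be the images of the two extra points.  Sums are
    then the elements of
      T = Q u (u + P') u (v + P')   together with   u + u, u + v, v + v,
    and differences are the elements of
      T u -T u {u - v, v - u}:
    by symmetry of P', u - P' = u + P'.  So every sum is a difference, with at
    most three exceptions, and it suffices to find, outside T, as many
    differences as there are sums outside T ([compensatedP]; the count itself is
    [leq_card_exchange]).

    Write M for the largest element of P' and D for its step, so D divides 2 M.
    Membership in P' or Q is then a bound plus a congruence mod D.  The points u
    and v may be exchanged, and both may be negated.  The configurations
    u in P', u = v and v = -u need at most one new difference, or are
    self-compensating.  In the others one may assume |v| < u, and - u - M, the
    least element of - u + P', is always a new difference ([fresh_extreme]).
    - If u - v is not in Q ([compensated_far]), the only way v - u can lie in T
      is by v - u being in u + P', and by symmetry of P' this puts u + u in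
      v + P', inside T.  Likewise u - v in T forces v + v in T.  So each of the
      two differences either is new or spares a sum, and - u - M pays for u + v.
    - If u - v is in Q ([compensated_near]), then u and v are congruent mod D
      and their distance is at least D and at most 2 M; three new differences
      are found near the ends of - u + P' and - v + P', except in a few cases
      where the congruences put some of the three sums in T. *)

(** * Divisibility of integers *)

Lemma dvdz_eq (D x y : int) : (D %| x)%Z -> x = y -> (D %| y)%Z.
Proof. by move=> h <-. Qed.
Arguments dvdz_eq {D x y}.

Lemma dvdz_leq (D x : int) : 0 < D -> 0 < x -> (D %| x)%Z -> D <= x.
Proof.
move=> D0 x0 /dvdzP[q xE]; move: x0; rewrite xE pmulr_lgt0 // => q0.
by rewrite ler_peMl //; lia.
Qed.

(** * Centred progressions, common values and new differences *)

(** [cprog D M] is membership in the progression P' = {-M, -M + D, ..., M}, when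
    D divides 2 M; [qprog D M] is membership in P' + P'. *)
Definition cprog (D M z : int) : bool := (`|z| <= M) && (D %| z + M)%Z.
Definition qprog (D M z : int) : bool := (`|z| <= M + M) && (D %| z)%Z.

(** The set T, made of sums that are visibly differences. *)
Definition common (D M u v z : int) : bool :=
  [|| qprog D M z, cprog D M (z - u) | cprog D M (z - v)].

(** Since Q is symmetric, the part - T of the difference set adds to T only
    - u + P' and - v + P'. *)
Definition fresh (D M u v z : int) : bool :=
  [|| cprog D M (z + u), cprog D M (z + v), z == u - v | z == v - u]
  && ~~ common D M u v z.

(** Every sum outside T is listed in [xs], and [ys] lists at least as many
    differences outside T. Using a list [xs] rather than a cardinal allows
    coincidences between u + u, u + v and v + v to be ignored. *)
Definition compensated (D M u v : int) : Prop :=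
  exists xs ys : seq int,
    [/\ uniq ys, all (fresh D M u v) ys, (size xs <= size ys)%N
      & forall z, z \in [:: u + u; u + v; v + v] ->
          common D M u v z || (z \in xs)].

Lemma cprogN D M z : (D %| M + M)%Z -> cprog D M (- z) = cprog D M z.
Proof.
move=> hM; rewrite /cprog normrN; congr (_ && _); apply/idP/idP => h.
  by apply: (dvdz_eq (rpredB hM h)); lia.
by apply: (dvdz_eq (rpredB hM h)); lia.
Qed.

Lemma qprogN D M z : qprog D M (- z) = qprog D M z.
Proof. by rewrite /qprog normrN rpredN. Qed.

Lemma commonC D M u v z : common D M u v z = common D M v u z.
Proof. by rewrite /common [cprog _ _ _ || _]orbC. Qed.

Lemma freshC D M u v z : fresh D M u v z = fresh D M v u z.
Proof. by rewrite /fresh commonC orbCA [(z == u - v) || _]orbC. Qed.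

Lemma compensatedC D M u v : compensated D M u v -> compensated D M v u.
Proof.
move=> [xs [ys [h1 h2 h3 h4]]]; exists xs, ys; split=> // [|z hz].
  by rewrite (eq_all (freshC _ _ _ _)).
rewrite commonC h4 //; move: hz; rewrite !inE (addrC v u).
by case/or3P=> ->; rewrite ?orbT.
Qed.

Lemma commonN D M u v z : (D %| M + M)%Z ->
  common D M (- u) (- v) (- z) = common D M u v z.
Proof. by move=> hM; rewrite /common qprogN -!opprD !cprogN. Qed.

Lemma compensatedN D M u v : (D %| M + M)%Z ->
  compensated D M (- u) (- v) -> compensated D M u v.
Proof.
move=> hM [xs [ys [h1 h2 h3 h4]]].
exists (map -%R xs), (map -%R ys); split=> [|||z hz].
- by rewrite map_inj_uniq //; exact: oppr_inj.
- rewrite all_map; apply: sub_all h2 => z /=.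
  rewrite /fresh -(commonN D M u v) // (opprK z) => /andP[+ ->]; rewrite andbT.
  rewrite -(cprogN _ _ (- z + u)) // -(cprogN _ _ (- z + v)) // !opprD !opprK.
  by case/or4P=> [->|->|/eqP->|/eqP->]; rewrite ?orbT // opprD !opprK eqxx ?orbT.
- by rewrite !size_map.
rewrite -(commonN D M u v) // -[X in X \in _]opprK (mem_map oppr_inj) h4 //.
by move: hz; rewrite !inE -!opprD !eqr_opp.
Qed.

(** For configurations in which u + u is the only sum that can escape T. *)
Lemma compensated_one D M u v :
  (forall z, z \in [:: u + u; u + v; v + v] ->
     common D M u v z \/ z = u + u) ->
  common D M u v (u + u) \/ (exists y, fresh D M u v y) ->
  compensated D M u v.
Proof.
move=> hz [hu|[y hy]]; last first.
  exists [:: u + u], [:: y]; split=> //=; first by rewrite hy.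
  by move=> z /hz; rewrite inE => -[->//|->]; rewrite eqxx orbT.
by exists [::], [::]; split=> // z /hz [->|->]//; rewrite hu.
Qed.

(** * New differences *)

(** The number - u - M lies below - M, so in Q it would force u into P'; it lies
    strictly below u + P' and, if - v < u, below v + P'; and v + P' is inside Q
    when v is in P'. *)
Lemma fresh_extreme D M u v : (D %| M + M)%Z -> 0 <= M ->
  ~~ cprog D M u -> 0 < u -> cprog D M v \/ - v < u ->
  fresh D M u v (- u - M).
Proof.
move=> hM M0 uP u0 vu; apply/andP; split.
  by rewrite /cprog (_ : - u - M + u = - M) ?addNr ?dvdz0; lia.
rewrite !negb_or; apply/and3P; split; apply/negP=> /andP[h1 h2]; try lia.
  case/negP: uP; apply/andP; split; first lia.
  by rewrite -rpredN; apply: (dvdz_eq h2); lia.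
case: vu => [/andP[v1 v2]|]; last lia.
case/negP: uP; apply/andP; split; first lia.
by rewrite -rpredN; apply: (dvdz_eq (rpredB (rpredD h2 v2) hM)); lia.
Qed.

(** The three sums are paid for separately: u + v by - u - M, u + u by v - u and
    v + v by u - v.  If the payment v - u is in T, then v - 2 u is in P', as it
    can lie neither in Q nor in v + P'; so u + u, at distance 2 u - v from v, is
    in T as well and needs no payment. *)
Lemma compensated_far D M u v : (D %| M + M)%Z -> 0 <= M ->
  ~~ cprog D M u -> ~~ cprog D M v -> - u < v < u -> ~~ qprog D M (u - v) ->
  compensated D M u v.
Proof.
move=> hM M0 uP vP /andP[uv vu] dQ.
have u0 : 0 < u by lia.
have fe : fresh D M u v (- u - M) by apply: fresh_extreme => //; lia.
have fu : ~~ common D M u v (u + u) -> fresh D M u v (v - u).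
  move=> c; rewrite /fresh eqxx !orbT /=.
  rewrite !negb_or -qprogN opprB dQ /=.
  rewrite (_ : v - u - v = - u) ?cprogN // ?uP ?andbT /=; last lia.
  apply: contra c => c; rewrite /common.
  by rewrite (_ : u + u - v = - (v - u - u)) ?cprogN // ?c ?orbT //; lia.
have fv : ~~ common D M u v (v + v) -> fresh D M u v (u - v).
  move=> c; rewrite /fresh eqxx !orbT /=.
  rewrite !negb_or dQ (_ : u - v - u = - v) ?cprogN // ?vP /=; last lia.
  apply: contra c => c; rewrite /common.
  by rewrite (_ : v + v - u = - (u - v - v)) ?cprogN // ?c ?orbT //; lia.
have vM : u <> M /\ v <> M /\ v <> - M.
  have end_r : cprog D M M by apply/andP; split=> //; lia.
  have end_l : cprog D M (- M) by rewrite cprogN.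
  by split; last split; [apply: contraNnot uP|apply: contraNnot vP..] => ->.
exists ((u + v) :: (if common D M u v (u + u) then [::] else [:: u + u])
        ++ (if common D M u v (v + v) then [::] else [:: v + v])).
exists ((- u - M) :: (if common D M u v (u + u) then [::] else [:: v - u])
        ++ (if common D M u v (v + v) then [::] else [:: u - v])).
split.
- by case: ifP => _; case: ifP => _ //=; rewrite !inE; lia.
- by case: ifPn => hu; case: ifPn => hv /=; rewrite ?fe ?fu ?fv.
- by case: ifP => _; case: ifP.
move=> z; rewrite !inE mem_cat => /or3P[] /eqP->.
- by case: ifP => c; rewrite ?c // inE eqxx !orbT.
- by rewrite eqxx !orbT.
- by case: (ifP (common D M u v (v + v))) => c; rewrite ?c // !inE eqxx !orbT.
Qed.

Lemma fresh_extreme_r D M u v : (D %| M + M)%Z -> 0 <= M ->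
  ~~ cprog D M v -> 0 < v <= u ->
  fresh D M u v (- v - M).
Proof. by move=> hM M0 vP vu; rewrite freshC fresh_extreme //; lia. Qed.

(** Three new differences pay for the three sums, whatever these are. *)
Lemma compensated3 D M u v y1 y2 y3 :
  uniq [:: y1; y2; y3] -> all (fresh D M u v) [:: y1; y2; y3] ->
  compensated D M u v.
Proof.
move=> h1 h2; exists [:: u + u; u + v; v + v], [:: y1; y2; y3]; split=> //.
by move=> z ->; rewrite orbT.
Qed.

(** Here u and v are congruent mod D and D <= u - v <= 2 M.
    - If u is congruent to M, then both u and v exceed M, since they are outside
      P' and at distance at most 2 M with |v| < u.  The differences - u - M,
      - v - M and - v - M + D are below - 2 M, hence new, unless v = M + D, when
      v + v is in u + P'.
    - If u is not congruent to M, then neither - u + P' nor - v + P' meets Q.  If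
      moreover D does not divide 2 u, they do not meet u + P' or v + P' either.
      If D divides 2 u, all three sums are multiples of D, so those of size at
      most 2 M lie in Q.
    In the second case, when M < v, the differences - u - M, - v - M and
    - v - M + D do again, whether or not D divides 2 u. *)
Lemma compensated_near D M u v : (D %| M + M)%Z -> 0 <= M -> 0 < D ->
  ~~ cprog D M u -> ~~ cprog D M v -> - u < v < u -> qprog D M (u - v) ->
  compensated D M u v.
Proof.
move=> hM M0 D0 uP vP /andP[uv vu] dQ.
have u0 : 0 < u by lia.
have fe : fresh D M u v (- u - M) by apply: fresh_extreme => //; lia.
case/andP: (dQ) => d1 d2.
have dD : D <= u - v by apply: dvdz_leq => //; lia.
have DM : D <= M + M by lia.
(* If M < v then - v - M + D < v - M, because D <= 2 M < 2 v; the premise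
   keeps it out of Q when its class mod D is that of Q. *)
have third : M < v -> ((D %| u + M)%Z -> M + D < v) -> compensated D M u v.
  move=> vM vM'.
  apply: (@compensated3 D M u v (- u - M) (- v - M) (- v - M + D)).
    by rewrite /= !inE; lia.
  rewrite /= fe fresh_extreme_r //=; last lia.
  rewrite andbT; apply/andP; split.
    apply/or4P; apply: Or42; apply/andP; split; first lia.
    by rewrite (_ : _ + M = D) ?dvdzz //; lia.
  rewrite !negb_or; apply/and3P; split; apply/negP=> /andP[h1 h2]; try lia.
  have : (D %| u + M)%Z.
    by apply: (dvdz_eq (rpredD (rpredB d2 h2) (dvdzz D))); lia.
  by move/vM'; lia.
have [uM|uM] := boolP (D %| u + M)%Z.
  have vM : (D %| v + M)%Z by apply: (dvdz_eq (rpredB uM d2)); lia.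
  have uM' : M < u by rewrite ltNge; apply: contra uP => h; apply/andP; split; lia.
  have vM' : M < v.
    by rewrite ltNge; apply: contra vP => h; apply/andP; split; lia.
  have vD : M + D <= v.
    have : D <= v - M by apply: dvdz_leq; [lia|lia|apply: (dvdz_eq (rpredB vM hM)); lia].
    by lia.
  (* If v = M + D then 2 v - u = M - ((u - v) - D), with 0 <= u - v - D < 2 M. *)
  have [vE|vE] := eqVneq v (M + D); last by apply: third => // _; lia.
  exists [:: u + u; u + v], [:: - u - M; - v - M]; split=> //.
  - by rewrite /= inE; lia.
  - by rewrite /= fe fresh_extreme_r //; lia.
  move=> z; rewrite !inE => /or3P[->|->|/eqP->]; rewrite ?orbT //.
  rewrite /common (_ : cprog D M (v + v - u)) ?orbT //; apply/andP; split; first lia.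
  by apply: (dvdz_eq (rpredB vM d2)); lia.
have [M'v|vM] := ltP M v; first by apply: third => // h; rewrite h in uM.
(* Now v <= M, so v + v can leave Q only for v < - M, which u - v <= 2 M and
   |v| < u exclude. *)
have [u2|u2] := boolP (D %| u + u)%Z.
  have v2 : (D %| v + v)%Z by apply: (dvdz_eq (rpredB (rpredB u2 d2) d2)); lia.
  have uv2 : (D %| u + v)%Z by apply: (dvdz_eq (rpredB u2 d2)); lia.
  have [v0|v0] := ltP 0 v.
    exists [:: u + u; u + v], [:: - u - M; - v - M]; split=> //.
    - by rewrite /= inE; lia.
    - by rewrite /= fe fresh_extreme_r //; lia.
    move=> z; rewrite !inE => /or3P[->|->|/eqP->]; rewrite ?orbT //.
    by rewrite /common /qprog v2 andbT; apply/orP; left; lia.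
  apply: compensated_one; last by right; exists (- u - M).
  move=> z; rewrite !inE => /or3P[/eqP->|/eqP->|/eqP->]; first by right.
    by left; rewrite /common /qprog uv2 andbT; apply/orP; left; lia.
  by left; rewrite /common /qprog v2 andbT; apply/orP; left; lia.
(* The sets u + P' and v + P' lie in one class mod D, and Q in another; the class
   of - u - M, which contains - u + P' and - v + P', is neither of them. *)
have avoid z : (D %| z + u + M)%Z -> ~~ common D M u v z.
  move=> hz; rewrite !negb_or; apply/and3P; split; apply/negP=> /andP[h1 h2].
  - by case/negP: uM; apply: (dvdz_eq (rpredB hz h2)); lia.
  - by case/negP: u2; apply: (dvdz_eq (rpredB hz h2)); lia.
  - by case/negP: u2; apply: (dvdz_eq (rpredD (rpredB hz h2) d2)); lia.
apply: (@compensated3 D M u v (- u - M) (- u - M + D) (- v + M)).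
  by rewrite /= !inE; lia.
rewrite /= fe andbT /=; apply/andP; split; apply/andP; split.
- rewrite (_ : cprog _ _ _) //; apply/andP; split; first lia.
  by apply: (dvdz_eq (dvdzz D)); lia.
- by apply: avoid; apply: (dvdz_eq (dvdzz D)); lia.
- rewrite (_ : cprog _ _ (_ + v)) ?orbT //; apply/andP; split; first lia.
  by apply: (dvdz_eq hM); lia.
- by apply: avoid; apply: (dvdz_eq (rpredD hM d2)); lia.
Qed.

(** Reduction of all configurations to 0 < u and |v| < u with u and v outside
    P', by exchanging u with v and by negation. *)
Lemma compensatedP D M u v : (D %| M + M)%Z -> 0 <= M -> 0 < D ->
  compensated D M u v.
Proof.
move=> hM M0 D0.
have common0 x y : common D M x y 0.
  by rewrite /common /qprog dvdz0 normr0; apply/orP; left; lia.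
(* If x is in P' or equal to y, the only sum that may escape T is y + y. *)
have one x y : cprog D M x \/ x = y -> compensated D M x y.
  wlog y0 : x y / 0 <= y => [hw xy|xy].
    have [y0|y0] := leP 0 y; first exact: hw.
    apply: compensatedN => //; apply: hw; first lia.
    by case: xy => [h|->]; [left; rewrite cprogN|right].
  have [yP|yP] := boolP (cprog D M y).
    have xP : cprog D M x by case: xy => [//|->].
    exists [::], [::]; split=> // z; rewrite !inE => /or3P[] /eqP->; apply/orP; left.
    - by rewrite /common addrK xP orbT.
    - by rewrite /common [x + y]addrC addrK yP !orbT.
    - by rewrite /common addrK yP !orbT.
  apply: compensatedC; apply: compensated_one => [z|].
    rewrite !inE => /or3P[] /eqP->; first by right.
      case: xy => [xP|->]; last by right.
      by left; rewrite /common [y + x]addrC addrK xP orbT.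
    case: xy => [xP|->]; last by right.
    by left; rewrite /common addrK xP !orbT.
  have [->|y1] := eqVneq y 0; first by left; rewrite addr0.
  right; exists (- y - M); apply: fresh_extreme => //; first lia.
  by case: xy => [xP|->]; [left|right; lia].
have [uP|uP] := boolP (cprog D M u); first by apply: one; left.
have [vP|vP] := boolP (cprog D M v); first by apply: compensatedC; apply: one; left.
have [|uv] := eqVneq u v; first by move=> ?; apply: one; right.
(* For v = - u the sums u + u and v + v are the differences u - v and v - u. *)
have [vE|uv'] := eqVneq v (- u).
  rewrite {v vP}vE in uv *.
  have cN : common D M u (- u) (- u - u) = common D M u (- u) (u + u).
    by rewrite commonC -{2}[u]opprK -opprD commonN.
  have [c|c] := boolP (common D M u (- u) (u + u)).
    exists [::], [::]; split=> // z; rewrite !inE => /or3P[] /eqP->.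
    - by rewrite orbF; exact: c.
    - by rewrite subrr common0.
    - by rewrite orbF; move: c; rewrite -cN.
  exists [:: u + u; - u - u], [:: u + u; - u - u]; split=> //.
  - by rewrite /= inE; lia.
  - by rewrite /= /fresh opprK !eqxx !orbT cN c.
  move=> z; rewrite !inE => /or3P[->|/eqP->|->]; rewrite ?orbT //.
  by rewrite subrr common0.
wlog vu : u v uP vP uv uv' / `|v| < `|u| => [hw|].
  have [vu|vu] := ltP `|v| `|u|; first exact: hw.
  by apply: compensatedC; apply: hw => //; lia.
wlog u0 : u v uP vP uv uv' vu / 0 < u => [hw|].
  have [u0|u0] := ltP 0 u; first exact: hw.
  by apply: compensatedN => //; apply: hw; rewrite ?cprogN //; lia.
have [dQ|dQ] := boolP (qprog D M (u - v)).
  by apply: compensated_near => //; lia.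
by apply: compensated_far => //; lia.
Qed.

(** * From compensation to cardinals *)

(** A is covered by the part of B where [t] holds, plus [xs]; and [ys] occupies
    at least as much room in the rest of B. *)
Lemma leq_card_exchange (K : choiceType) (A B : {fset K}) (t : pred K) xs ys :
  (forall z, z \in A -> (z \in B) && t z || (z \in xs)) ->
  uniq ys -> (forall z, z \in ys -> (z \in B) && ~~ t z) ->
  (size xs <= size ys)%N -> (#|` A| <= #|` B|)%N.
Proof.
move=> hA hu hB hs; pose T := filter t (enum_fset B).
have hAT : (#|` A| <= size (T ++ xs))%N.
  apply: uniq_leq_size; first exact: fset_uniq.
  by move=> z /hA; rewrite mem_cat mem_filter andbC.
apply: leq_trans hAT _; apply: (@leq_trans (size (T ++ ys))).
  by rewrite !size_cat leq_add2l.
apply: uniq_leq_size.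
  rewrite cat_uniq filter_uniq ?fset_uniq // hu andbT /=.
  by apply/hasPn => z /hB /andP[_ tz]; rewrite mem_filter negb_and tz.
by move=> z; rewrite mem_cat mem_filter => /orP[/andP[]//|/hB/andP[]].
Qed.

(** The affine map z |-> 2 z - 2 c on sums and the map z |-> 2 z on differences
    are injective and turn them into f x + f y and f x - f y, so that all the
    counting takes place in the centred coordinate f. *)
Lemma leq_card_sumset (D M c : int) (m1 m2 : nat) (A : {fset nat})
    (f := fun x : nat => x%:Z + x%:Z - c : int) :
  (D %| M + M)%Z -> 0 <= M -> 0 < D ->
  (forall x, x \in A -> cprog D M (f x) \/ x = m1 \/ x = m2) ->
  (forall z, cprog D M z -> exists2 x, x \in A & z = f x) ->
  m1 \in A -> m2 \in A ->
  (#|` sumset A| <= #|` diffset A|)%N.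
Proof.
move=> hM M0 D0 fA Af m1A m2A.
have [xs [ys [uys hys sxy hxs]]] := compensatedP D M (f m1) (f m2) hM M0 D0.
pose scale (z : int) : int := z + z.
pose shift (s : nat) : int := s%:Z + s%:Z - (c + c).
pose S := [fset shift s | s in sumset A]%fset.
pose E := [fset scale z | z in diffset A]%fset.
have -> : #|` diffset A| = #|` E| by rewrite card_imfset //= /scale => x y; lia.
have -> : #|` sumset A| = #|` S| by rewrite card_imfset //= /shift => x y; lia.
have fE x y : x \in A -> y \in A -> f x - f y \in E.
  move=> xA yA; apply/imfsetP; exists (x%:Z - y%:Z); last by rewrite /scale /f; lia.
  by apply/imfset2P; exists x => //; exists y.
have PE p q : cprog D M p -> cprog D M q -> p - q \in E.
  by move=> /Af[x xA ->] /Af[y yA ->]; exact: fE.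
have PME : cprog D M M by apply/andP; split; first lia.
have cE z : common D M (f m1) (f m2) z -> z \in E.
  case/or3P=> [/andP[h1 h2]|h|h].
  - have [z0|z0] := leP 0 z.
      rewrite (_ : z = M - (M - z)); last lia.
      apply: PE => //; apply/andP; split; first lia.
      by apply: (dvdz_eq (rpredB hM h2)); lia.
    rewrite (_ : z = (M + z) - M); last lia.
    apply: PE => //; apply/andP; split; first lia.
    by apply: (dvdz_eq (rpredD hM h2)); lia.
  - have : cprog D M (- (z - f m1)) by rewrite cprogN.
    case/Af=> y yA yE; rewrite (_ : z = f m1 - f y); last by rewrite -yE; lia.
    exact: fE.
  - have : cprog D M (- (z - f m2)) by rewrite cprogN.
    case/Af=> y yA yE; rewrite (_ : z = f m2 - f y); last by rewrite -yE; lia.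
    exact: fE.
apply: (@leq_card_exchange _ S E (common D M (f m1) (f m2)) xs ys) => // z.
  case/imfsetP=> _ /imfset2P[x xA [y yA ->]] ->.
  have -> : shift (x + y)%N = f x + f y by rewrite /shift /f; lia.
  suff : common D M (f m1) (f m2) (f x + f y) || (f x + f y \in xs).
    by case/orP=> h; apply/orP; [left; apply/andP; split=> //; exact: cE|right].
  have PC p m : cprog D M p -> m = m1 \/ m = m2 ->
      common D M (f m1) (f m2) (p + f m).
    by move=> h [->|->]; rewrite /common addrK h !orbT.
  have [fx|fx] := fA _ xA; have [fy|fy] := fA _ yA.
  - apply/orP; left; apply/or3P; apply: Or31.
    case/andP: fx => x1 x2; case/andP: fy => y1 y2; apply/andP; split; first lia.
    by apply: (dvdz_eq (rpredB (rpredD x2 y2) hM)); lia.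
  - by rewrite PC.
  - by rewrite addrC PC.
  - apply: hxs; rewrite !inE.
    by case: fx => ->; case: fy => ->; rewrite ?eqxx ?orbT // [f m2 + _]addrC eqxx ?orbT.
move=> /(allP hys) /andP[h ->]; rewrite andbT.
have [xm1 xm2] := (fE _ _ m1A m2A, fE _ _ m2A m1A).
have PR m : m \in A -> cprog D M (z + f m) -> z \in E.
  by move=> mA /Af[x xA xE]; rewrite (_ : z = f x - f m) ?fE // -xE; lia.
by case/or4P: h => [/PR->|/PR->|/eqP->|/eqP->].
Qed.

Local Open Scope fset_scope.

Theorem theorem2 (a d n m1 m2 : nat) (hd : (1 <= d)%N) (hn : (1 <= n)%N) :
  ~ sum_dominant (arith_prog a d n `|` [fset m1; m2]).
Proof.
apply/negP; rewrite -leqNgt.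
pose M : int := (n.-1 * d)%N%:Z; pose D : int := (d + d)%N%:Z.
have hM : (D %| (M + M)%R)%Z by apply/dvdzP; exists n.-1%:Z; rewrite /M /D; lia.
(* The sum of the first and last terms is c = 2 a + M. *)
apply: (@leq_card_sumset D M ((a + a)%N%:Z + M)%R m1 m2) => //.
- by rewrite /D; lia.
- move=> x; rewrite !inE => /or3P[|/eqP->|/eqP->]; [|by right; left|by right; right].
  move=> /imfsetP[i /= hi ->]; left; rewrite mem_iota in hi; apply/andP; split.
    by rewrite /M; nia.
  by apply/dvdzP; exists (i : int); rewrite /M /D; lia.
- move=> z /andP[h1 /dvdzP[k hk]].
  have k0 : (0 <= k)%R by rewrite /M /D in h1 hk; nia.
  have kn : (k <= n.-1)%R by rewrite /M /D in h1 hk; nia.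
  exists (a + `|k| * d)%N; last by rewrite /D /M in hk *; nia.
  rewrite inE; apply/orP; left; apply/imfsetP; exists `|k|%N => //=.
  by rewrite mem_iota; lia.
- by rewrite !inE eqxx orbT.
- by rewrite !inE eqxx !orbT.
Qed.
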